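(* Let $\mathcal{H}$ be a complex Hilbert space and let $A,B\in\mathcal{B}(\mathcal{H})$. Then for all real $r\geq1$, $$ w^{2r}(B^*A)\leq\frac{1}{2}\left(\frac{\left\||B|^{2}|A|^{2}+|A|^{2}|B|^{2}\right\|}{2}\right)^r+\frac{1}{4}\left\||B|^{4r}+|A|^{4r}\right\|. $$
   Context: $\mathcal{B}(\mathcal{H})$ denotes the $C^*$-algebra of bounded linear operators on the complex Hilbert space $\mathcal{H}$, with operator norm $\|\cdot\|$. For $T\in\mathcal{B}(\mathcal{H})$, $|T|=(T^*T)^{1/2}$, and powers of $|T|$ are taken by the continuous functional calculus. The numerical radius is $w(T)=\sup\{|\langle Tx,x\rangle|: x\in\mathcal{H},\ \|x\|=1\}$, and $w^{s}(T)=(w(T))^{s}$. *)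

(* Defs.v *)
From HB Require Import structures.
From mathcomp Require Import all_boot all_order all_algebra sesquilinear.
From mathcomp Require Import complex.
From mathcomp Require Import boolp classical_sets functions reals topology.
From mathcomp Require Import normedtype exp.

Set Implicit Arguments.
Unset Strict Implicit.
Unset Printing Implicit Defensive.

Import Order.TTheory GRing.Theory Num.Theory.
Import numFieldNormedType.Exports.

Local Open Scope classical_set_scope.
Local Open Scope ring_scope.
Local Open Scope complex_scope.

(* The inner product is linear in its first argument and conjugate-linear in
   the second one. *)
HB.mixin Record isHilbert (R : realType) H
    & CompleteNormedModule R[i] H := {
  inner : {dot H for @conjc R} ;
  inner_norm : forall x : H, inner x x = `|x| ^+ 2
}.

#[short(type="hilbertType")]
HB.structure Definition Hilbert (R : realType) :=
  { H of CompleteNormedModule R[i] H & isHilbert R H }.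

Section BoundedOperators.
Variables (R : realType) (H : hilbertType R).

Definition bounded_linear (T : H -> H) : Prop :=
  linear T /\ exists M : R, forall x, `|T x| <= M%:C * `|x|.

Definition bounded_linear_pred : {pred (H -> H)} :=
  fun T => `[< bounded_linear T >].

Lemma bounded_linear_submod : submod_closed bounded_linear_pred.
Proof.
split=> [|a f g /asboolP[fl [M fM]] /asboolP[gl [N gN]]]; apply/asboolP; split.
- by move=> b x y; rewrite /= scaler0 addr0.
- by exists 0 => x; rewrite normr0 mul0r.
- move=> b x y; rewrite !fctE fl gl !scalerDr !scalerA (mulrC a) -!addrA.
  by congr (_ + _); rewrite addrCA.
- exists (complex.Re `|a| * M + N) => x; rewrite !fctE.
  have -> : (complex.Re `|a| * M + N)%:C = `|a| * M%:C + N%:C.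
    by rewrite rmorphD rmorphM; congr (_ * _ + _); rewrite RRe_real ?normr_real.
  rewrite mulrDl -mulrA (le_trans (ler_normD _ _)) // lerD // normrZ.
  exact: ler_wpM2l.
Qed.

HB.instance Definition _ :=
  GRing.isSubmodClosed.Build R[i] (H -> H) bounded_linear_pred
    bounded_linear_submod.

Record bop := Bop {
  bop_fun :> H -> H ;
  bop_subproof : bop_fun \in bounded_linear_pred
}.

HB.instance Definition _ := [isSub for bop_fun].
HB.instance Definition _ := [Choice of bop by <:].
HB.instance Definition _ := [SubChoice_isSubLmodule of bop by <:].

Lemma bop_bounded_linear (T : bop) : bounded_linear T.
Proof. exact/asboolP/(bop_subproof T). Qed.

HB.instance Definition _ (T : bop) :=
  GRing.isLinear.Build R[i] H H _ (bop_fun T) (bop_bounded_linear T).1.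

Lemma bopP (S T : bop) : S =1 T -> S = T.
Proof. by move=> ST; apply/val_inj/funext. Qed.

Lemma bop1_subproof : (@id H) \in bounded_linear_pred.
Proof. by apply/asboolP; split=> //; exists 1 => x; rewrite mul1r. Qed.

Definition bop1 : bop := Bop bop1_subproof.

Lemma bopM_subproof (S T : bop) : (S \o T) \in bounded_linear_pred.
Proof.
apply/asboolP; split=> [a x y /=|]; first by rewrite !linearP.
have [[_ [M SM]] [_ [N TN]]] := (bop_bounded_linear S, bop_bounded_linear T).
exists (Num.max M 0 * N) => x /=; rewrite (le_trans (SM _)) //.
rewrite (@le_trans _ _ ((Num.max M 0)%:C * `|T x|)) //.
  by rewrite ler_wpM2r // lecR le_max lexx.
by rewrite rmorphM -mulrA ler_wpM2l // ler0c le_max lexx orbT.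
Qed.

Definition bopM (S T : bop) : bop := Bop (bopM_subproof S T).

Lemma bopMA : associative bopM. Proof. by move=> S T U; exact: bopP. Qed.
Lemma bop1M : left_id bop1 bopM. Proof. by move=> T; exact: bopP. Qed.
Lemma bopM1 : right_id bop1 bopM. Proof. by move=> T; exact: bopP. Qed.
Lemma bopMDl : left_distributive bopM +%R.
Proof. by move=> S T U; exact: bopP. Qed.
Lemma bopMDr : right_distributive bopM +%R.
Proof. by move=> S T U; apply: bopP => x /=; rewrite linearD. Qed.

HB.instance Definition _ :=
  GRing.Zmodule_isPzRing.Build bop bopMA bop1M bopM1 bopMDl bopMDr.

(* Norms and moduli are nonnegative elements of R[i]; complex.Re turns them
   into elements of R. *)
Definition opnorm (T : bop) : R :=
  sup [set complex.Re `|T x| | x in [set x : H | `|x| <= 1]].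

Definition numradius (T : bop) : R :=
  sup [set complex.Re `|inner (T x) x| | x in [set x : H | `|x| = 1]].

(* xget returns its default 0 when no operator is in the set, which by the
   Riesz representation theorem does not happen here. *)
Definition adj (T : bop) : bop :=
  xget 0 [set S : bop | forall x y, inner (T x) y = inner x (S y)].

Definition spectrum (T : bop) : set R[i] :=
  [set z | ~ exists S : bop,
    S * (T - z *: (1 : bop)) = 1 /\ (T - z *: (1 : bop)) * S = 1].

Definition bop_horner (p : {poly R}) (T : bop) : bop :=
  \sum_(i < size p) (p`_i)%:C *: T ^+ i.

(* Continuous functional calculus of a self-adjoint operator T, whose spectrum
   is real: f(T) is the operator-norm limit of p_n(T), for real polynomials p_n
   converging to f uniformly on the spectrum of T. *)
Definition is_cfc (f : R -> R) (T X : bop) : Prop :=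
  forall e : R, 0 < e -> exists p : {poly R},
    (forall t : R, spectrum T t%:C -> `|p.[t] - f t| <= e) /\
    opnorm (bop_horner p T - X) <= e.

Definition cfc (f : R -> R) (T : bop) : bop := xget 0 [set X | is_cfc f T X].

(* Only meant for T >= 0 and s > 0. *)
Definition bop_powR (T : bop) (s : R) : bop := cfc (fun t => t `^ s) T.

Definition bop_abs (T : bop) : bop := bop_powR (adj T * T) 2^-1.

End BoundedOperators.

(* Main.v *)
Require Import Defs.
From mathcomp Require Import all_boot all_order all_algebra.
From mathcomp Require Import sesquilinear complex ring lra.
From mathcomp Require Import boolp classical_sets topology normedtype.
From mathcomp Require Import reals exp.
Import GRing.Theory Num.Theory.
Import Order.TTheory numFieldNormedType.Exports.
Local Open Scope ring_scope.

Set Implicit Arguments.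
Unset Strict Implicit.
Unset Printing Implicit Defensive.

(* For a unit vector x, P = A^*A and Q = B^*B, Cauchy-Schwarz gives
   |<B^*A x, x>|^2 <= <P x, x> <Q x, x>. Buzano's inequality, taken for the real
   inner product Re <., .>, bounds the right-hand side by
   (|P x| |Q x| + Re <P x, Q x>) / 2, and Re <P x, Q x> = <(QP + PQ) x, x> / 2.
   Convexity of t^r and McCarthy's inequality
   (|P x|^2)^r = <P^2 x, x>^r <= <P^(2r) x, x> then conclude.

   The functional calculus rests on |f(T)| <= sup |f| over the spectrum, for a
   self-adjoint T and a real polynomial f: f(T)^2 - |f(T)|^2 is not invertible,
   so one of the factors T - c of the complex polynomial f^2 - |f(T)|^2 is not
   invertible either. Adjoints and inverses of coercive operators both come
   from minimising a quadratic functional. *)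

Lemma natinv_le (R : realType) (e : R) :
  0 < e -> exists N, forall n, (N <= n)%N -> n.+1%:R^-1 <= e.
Proof.
move=> e0; exists (Num.truncn e^-1) => n Nn.
rewrite invf_ple ?posrE ?ltr0n //.
by rewrite (le_trans (ltW (truncnS_gt e^-1))) // ler_nat ltnS.
Qed.

(** * The real inner product *)

Section RealInner.
Local Open Scope complex_scope.
Variables (R : realType) (H : hilbertType R).
Implicit Types (x y z : H) (a : R) (c : R[i]).

(** Norms and inner products live in [R[i]]; their real parts live in the ordered field [R], where
    suprema, infima and linear arithmetic are available. *)
Definition nm x : R := complex.Re `|x|.
Definition rin x y : R := complex.Re (inner x y).

Lemma nmE x : `|x| = (nm x)%:C.
Proof. by rewrite /nm RRe_real // normr_real. Qed.

Lemma nm_ge0 x : 0 <= nm x.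
Proof. by rewrite -ler0c -nmE. Qed.

Lemma nm0 : nm 0 = 0.
Proof. by rewrite /nm normr0. Qed.

Lemma nm_eq0 x : nm x = 0 -> x = 0.
Proof. by move=> h; apply/eqP; rewrite -normr_eq0 nmE h. Qed.

Lemma ler_nmD x y : nm (x + y) <= nm x + nm y.
Proof. by rewrite -lecR [(nm x + nm y)%:C]rmorphD /= -!nmE ler_normD. Qed.

Lemma nmN x : nm (- x) = nm x.
Proof. by rewrite /nm normrN. Qed.

Lemma nm_distC x y : nm (x - y) = nm (y - x).
Proof. by rewrite /nm distrC. Qed.

Lemma nmZ c x : nm (c *: x) = complex.Re `|c| * nm x.
Proof.
apply: complexI; rewrite [RHS]rmorphM /= -!nmE normrZ; congr (_ * _).
Qed.

Lemma normC_real a : complex.Re `|a%:C| = `|a|.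
Proof. by rewrite normc_def /= expr0n addr0 sqrtr_sqr. Qed.

Lemma nmZr a x : nm (a%:C *: x) = `|a| * nm x.
Proof. by rewrite nmZ normC_real. Qed.

Lemma innerC x y : inner x y = (inner y x)^*.
Proof. by rewrite (hermC inner) expr0 mul1r. Qed.

Lemma rinC x y : rin x y = rin y x.
Proof. by rewrite /rin innerC; case: (inner y x). Qed.

Lemma rinDl x y z : rin (x + y) z = rin x z + rin y z.
Proof. by rewrite /rin linearDl raddfD. Qed.

Lemma rinDr x y z : rin z (x + y) = rin z x + rin z y.
Proof. by rewrite rinC rinDl !(rinC z). Qed.

Lemma rinZl a x y : rin (a%:C *: x) y = a * rin x y.
Proof.
by rewrite /rin linearZl_LR /=; case: (inner x y) => u v /=; rewrite mul0r subr0.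
Qed.

Lemma rinZr a x y : rin x (a%:C *: y) = a * rin x y.
Proof. by rewrite rinC rinZl rinC. Qed.

Lemma rinNl x y : rin (- x) y = - rin x y.
Proof. by rewrite /rin linearNl raddfN. Qed.

Lemma rinNr x y : rin x (- y) = - rin x y.
Proof. by rewrite rinC rinNl rinC. Qed.

Lemma rinBl x y z : rin (x - y) z = rin x z - rin y z.
Proof. by rewrite rinDl rinNl. Qed.

Lemma rinBr x y z : rin z (x - y) = rin z x - rin z y.
Proof. by rewrite rinDr rinNr. Qed.

Lemma rin0l x : rin 0 x = 0.
Proof. by have := rinBl 0 0 x; rewrite subrr subrr. Qed.

Lemma rinxx x : rin x x = nm x ^+ 2.
Proof. by rewrite /rin inner_norm nmE -rmorphXn. Qed.

(** The second slot is conjugate-linear, so replacing [y] by ['i *: y] multiplies the inner product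
    by [- 'i] and moves its imaginary part to the real part. Identities for [inner] thus reduce to
    [rin]. *)
Lemma innerE x y : inner x y = rin x y +i* rin x ('i *: y).
Proof.
rewrite /rin (innerC x ('i *: y)) linearZl_LR (innerC x y) /=.
case: (inner y x) => u v /=.
by rewrite !mul0r !mul1r sub0r.
Qed.

Lemma rin_i x y : rin ('i *: x) ('i *: y) = rin x y.
Proof.
rewrite /rin linearZl_LR /= (innerC x) linearZl_LR /= (innerC y).
by case: (inner x y) => u v /=; rewrite !(mul0r, mul1r, sub0r, add0r, addr0) opprK.
Qed.

Lemma rin_inj x y : (forall z, rin z x = rin z y) -> x = y.
Proof.
move=> h; apply/eqP; rewrite -subr_eq0; apply/eqP/nm_eq0/eqP.
by rewrite -sqrf_eq0 -rinxx rinBr h subrr.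
Qed.

Lemma nm_sqrD x y : nm (x + y) ^+ 2 = nm x ^+ 2 + 2 * rin x y + nm y ^+ 2.
Proof. by rewrite -!rinxx rinDl !rinDr (rinC y x); ring. Qed.

Lemma nm_sqrB x y : nm (x - y) ^+ 2 = nm x ^+ 2 - 2 * rin x y + nm y ^+ 2.
Proof. by rewrite nm_sqrD rinNr nmN mulrN. Qed.

Lemma rin_le x y : rin x y <= nm x * nm y.
Proof.
have [/nm_eq0 ->|x0] := eqVneq (nm x) 0; first by rewrite rin0l nm0 mul0r.
have [/nm_eq0 ->|y0] := eqVneq (nm y) 0.
  by rewrite rinC rin0l nm0 mulr0.
have px : 0 < nm x by rewrite lt_def x0 nm_ge0.
have py : 0 < nm y by rewrite lt_def y0 nm_ge0.
(* Expanding this square gives [2 * nm x * nm y] times [nm x * nm y - rin x y]. *)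
have := sqr_ge0 (nm ((nm y)%:C *: x - (nm x)%:C *: y)).
rewrite nm_sqrB rinZl rinZr !nmZr !(ger0_norm (nm_ge0 _)) => h.
rewrite -(ler_pM2l (mulr_gt0 px py)).
by move: h; rewrite (mulrC (nm y) (nm x)); lra.
Qed.

Lemma rin_abs x y : `|rin x y| <= nm x * nm y.
Proof.
by rewrite ler_norml rin_le andbT lerNl -rinNl (le_trans (rin_le _ _)) // nmN.
Qed.

(** Rotating [x] by a unit scalar makes the inner product real and nonnegative, which reduces the
    claim to its real part. *)
Lemma inner_abs x y : complex.Re `|inner x y| <= nm x * nm y.
Proof.
have [->|i0] := eqVneq (inner x y) 0.
  by rewrite normr0 mulr_ge0 ?nm_ge0.
set w := inner x y in i0 *.
pose c := `|w| / w.
have cw : c * w = `|w| by rewrite /c mulfVK.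
have c1 : `|c| = 1 by rewrite /c normrM normfV normr_id mulfV // normr_eq0.
have -> : complex.Re `|w| = rin (c *: x) y by rewrite /rin linearZl_LR /= cw.
by rewrite (le_trans (rin_le _ _)) // nmZ c1 /= mul1r.
Qed.

End RealInner.

(** * Operator norm *)

Section OpNorm.
Local Open Scope complex_scope.
Variables (R : realType) (H : hilbertType R).
Implicit Types (x y z : H) (a : R) (c : R[i]) (S T : bop H).

Lemma nm_complete (u : nat -> H) :
  (forall e : R, 0 < e -> exists N, forall m n, (N <= m)%N -> (N <= n)%N ->
    nm (u m - u n) <= e) ->
  exists l, forall e : R, 0 < e -> exists N, forall n, (N <= n)%N ->
    nm (u n - l) <= e.
Proof.
move=> uC; have : cvg (u @ \oo)%classic.
  (* Radii are elements of [R[i]]; a positive one has zero imaginary part. *)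
  apply/cauchy_cvgP/cauchy_exP => -[e1 e2]; rewrite ltcE /= => /andP[/eqP -> e0].
  have [N NP] := uC _ (divr_gt0 e0 (ltr0n R 2)).
  exists (u N); exists N => //= n /= Nn.
  rewrite -ball_normE /= nmE ltcR (le_lt_trans (NP _ _ _ Nn)) //.
  by rewrite ltr_pdivrMr ?ltr0n // ltr_pMr // ltr1n.
move=> /cvg_ex[l ul]; exists l => e e0.
move/cvgrPdist_lt: ul => /(_ e%:C); rewrite ltcR => /(_ e0)[N _ NP].
exists N => n Nn; have := NP n Nn.
by rewrite /= nmE ltcR nm_distC => /ltW.
Qed.

Lemma bop_bounded T : exists2 M, 0 <= M & forall x, nm (T x) <= M * nm x.
Proof.
have [_ [M TM]] := bop_bounded_linear T.
exists `|M| => // x; rewrite (@le_trans _ _ (M * nm x)) //.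
  by rewrite -lecR -nmE [(M * _)%:C]rmorphM /= -nmE.
by rewrite ler_wpM2r ?nm_ge0 // ler_norm.
Qed.

Lemma opnorm_has_sup T :
  has_sup [set complex.Re `|T x| | x in [set x : H | `|x| <= 1]]%classic.
Proof.
split; first by exists (nm (T 0)), 0 => //=; rewrite normr0.
have [M M0 TM] := bop_bounded T.
exists M => _ [x /= x1 <-]; rewrite (le_trans (TM x)) // ler_piMr //.
by rewrite -lecR -nmE.
Qed.

Lemma opnorm_ge0 T : 0 <= opnorm T.
Proof.
apply: (le_trans (nm_ge0 (T 0))); apply: ub_le_sup.
  by have [] := opnorm_has_sup T.
by exists 0 => //=; rewrite normr0.
Qed.

Lemma opnorm_le T x : nm (T x) <= opnorm T * nm x.
Proof.
have [/nm_eq0 ->|x0] := eqVneq (nm x) 0; first by rewrite linear0 nm0 mulr0.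
have px : 0 < nm x by rewrite lt_def x0 nm_ge0.
rewrite -ler_pdivrMr // mulrC -{1}[(nm x)^-1]ger0_norm ?invr_ge0 ?nm_ge0 //.
rewrite -nmZr -linearZ; apply: ub_le_sup.
  by have [] := opnorm_has_sup T.
exists ((nm x)^-1%:C *: x) => //=.
by rewrite nmE nmZr ger0_norm ?invr_ge0 ?nm_ge0 // mulVf // lecR.
Qed.

Lemma opnorm_lub T a :
  0 <= a -> (forall x, nm (T x) <= a * nm x) -> opnorm T <= a.
Proof.
move=> a0 Ta; apply: ge_sup; first by have [] := opnorm_has_sup T.
move=> _ [x /= x1 <-]; rewrite (le_trans (Ta x)) // ler_piMr //.
by rewrite -lecR -nmE.
Qed.

Lemma ler_opnormD S T : opnorm (S + T) <= opnorm S + opnorm T.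
Proof.
apply: opnorm_lub => [|x]; first by rewrite addr_ge0 ?opnorm_ge0.
by rewrite mulrDl (le_trans (ler_nmD _ _)) // lerD ?opnorm_le.
Qed.

Lemma opnormN T : opnorm (- T) = opnorm T.
Proof.
by rewrite /opnorm; congr (sup (image _ _)); apply/funext => x /=; rewrite normrN.
Qed.

Lemma opnorm_distC S T : opnorm (S - T) = opnorm (T - S).
Proof. by rewrite -opnormN opprB. Qed.

Lemma ler_opnormM S T : opnorm (S * T) <= opnorm S * opnorm T.
Proof.
apply: opnorm_lub => [|x]; first by rewrite mulr_ge0 ?opnorm_ge0.
rewrite (le_trans (opnorm_le S (T x))) // -mulrA ler_wpM2l ?opnorm_ge0 //.
exact: opnorm_le.
Qed.

Lemma rin_opnorm T x : `|rin (T x) x| <= opnorm T * nm x ^+ 2.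
Proof.
rewrite (le_trans (rin_abs _ _)) // expr2 mulrA ler_wpM2r ?nm_ge0 //.
exact: opnorm_le.
Qed.

Lemma bopD_arg T x y : T (x + y) = T x + T y. Proof. exact: linearD. Qed.
Lemma bopB_arg T x y : T (x - y) = T x - T y. Proof. exact: linearB. Qed.
Lemma bopZ_arg T c x : T (c *: x) = c *: T x. Proof. exact: linearZ. Qed.

Lemma bopDE S T x : (S + T) x = S x + T x. Proof. by []. Qed.
Lemma bopBE S T x : (S - T) x = S x - T x. Proof. by []. Qed.
Lemma bopZE c T x : (c *: T) x = c *: T x. Proof. by []. Qed.
Lemma bopME S T x : (S * T) x = S (T x). Proof. by []. Qed.
Lemma bop1E x : (1 : bop H) x = x. Proof. by []. Qed.

Lemma bop_nmB_eq0 S T :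
  (forall e : R, 0 < e -> opnorm (S - T) <= e) -> S = T.
Proof.
move=> h; have T0 : opnorm (S - T) = 0.
  apply/eqP; rewrite eq_le opnorm_ge0 andbT.
  by apply/ler_addgt0Pl => e e0; rewrite addr0 h.
apply: bopP => x; apply/eqP; rewrite -subr_eq0; apply/eqP/nm_eq0/eqP.
rewrite eq_le nm_ge0 andbT; have := opnorm_le (S - T) x.
by rewrite T0 mul0r.
Qed.

End OpNorm.

(** * Coercive operators *)

Section Coercive.
Local Open Scope complex_scope.
Variables (R : realType) (H : hilbertType R).
Implicit Types (x y z : H) (a : R) (c : R[i]) (S T : bop H).

Definition symmetric_op T := forall x y, rin (T x) y = rin x (T y).

(** For small [t] the linear term would dominate. The witness [- g / (q + 1)], whose denominator is
    positive even for [q = 0], gives [- g ^+ 2 * (q + 2)] up to a positive factor. *)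
Lemma quadratic_ge0_eq0 (q g : R) :
  0 <= q -> (forall t, 0 <= t ^+ 2 * q + 2 * t * g) -> g = 0.
Proof.
move=> q0 /(_ (- g / (q + 1))) h; apply/eqP; rewrite -sqrf_eq0 eq_le sqr_ge0 andbT.
have q1 : 0 < q + 1 by lra.
have {h} : 0 <= (q + 1) ^+ 2 * ((- g / (q + 1)) ^+ 2 * q + 2 * (- g / (q + 1)) * g).
  by rewrite mulr_ge0 ?sqr_ge0.
have -> : (q + 1) ^+ 2 * ((- g / (q + 1)) ^+ 2 * q + 2 * (- g / (q + 1)) * g)
  = - g ^+ 2 * (q + 2) by field; rewrite gt_eqF.
by rewrite mulNr oppr_ge0 pmulr_lle0 //; lra.
Qed.

(* The solution y minimises the functional <M x, x> - 2 f x; coercivity and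
   the parallelogram identity make minimising sequences Cauchy. *)
Lemma coercive_solve (M : bop H) (a K : R) (f : H -> R) :
  0 < a -> symmetric_op M -> (forall x, a * nm x ^+ 2 <= rin (M x) x) ->
  (forall x y, f (x + y) = f x + f y) ->
  (forall t x, f (t%:C *: x) = t * f x) ->
  (forall x, `|f x| <= K * nm x) ->
  exists y, forall x, f x = rin x (M y).
Proof.
move=> a0 Msym Mge fD fZ fK.
pose J x := rin (M x) x - 2 * f x.
have JD x h t : J (x + t%:C *: h) =
    J x + (t ^+ 2 * rin (M h) h + 2 * t * (rin (M x) h - f h)).
  rewrite /J bopD_arg bopZ_arg fD fZ !rinDl !rinDr !rinZl !rinZr.
  by rewrite (Msym h x) (rinC h (M x)); ring.
have Jmid x y : rin (M (x - y)) (x - y) =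
    2 * J x + 2 * J y - 4 * J ((2^-1)%:C *: (x + y)).
  have: 2^-1 * 2 = 1 :> R by rewrite mulVf ?pnatr_eq0.
  move: (2^-1 : R) => s s2; rewrite /J fZ fD bopZ_arg bopB_arg bopD_arg.
  rewrite !rinZl !rinZr !rinDl !rinDr !rinNl !rinNr (Msym y x) (rinC y).
  have -> : s = 2^-1.
    by apply: (mulIf (x := 2)); rewrite ?pnatr_eq0 // s2 mulVf ?pnatr_eq0.
  by field.
(* Completing the square in [nm x] bounds [J] from below. *)
have Jge x : - (K ^+ 2 / a) <= J x.
  have := Mge x; have := fK x; rewrite ler_norml => /andP[_ fx] Mx.
  have : 0 <= (a * nm x - K) ^+ 2 / a by rewrite mulr_ge0 ?sqr_ge0 ?invr_ge0 ?ltW.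
  have -> : (a * nm x - K) ^+ 2 / a = a * nm x ^+ 2 - 2 * (K * nm x) + K ^+ 2 / a.
    by field; rewrite gt_eqF.
  by rewrite /J; lra.
have Jinf : has_inf (range J).
  by split; [exists (J 0), 0|exists (- (K ^+ 2 / a)) => _ [x _ <-]].
set m := inf (range J).
have Jm x : m <= J x by apply: ge_inf; [case: Jinf|exists x].
have /choice[u uP] n : exists x, J x < m + n.+1%:R^-1.
  have n0 : 0 < n.+1%:R^-1 :> R by rewrite invr_gt0 ltr0n.
  by have [_ [x _ <-] Jx] := inf_adherent n0 Jinf; exists x.
have [|l ul] := @nm_complete _ _ u.
  (* If [J (u p)] and [J (u q)] are within [d] of [m], [Jmid] bounds [a * nm (u p - u q) ^+ 2] by
     [4 * d], whence the choice of [a * e ^+ 2 / 4]. *)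
  move=> e e0; have [|N NP] := @natinv_le _ (a * e ^+ 2 / 4).
    by rewrite divr_gt0 ?mulr_gt0 ?exprn_gt0.
  exists N => p q /NP pN /NP qN.
  rewrite -(ler_pXn2r (n := 2)) ?nnegrE ?nm_ge0 ?(ltW e0) //.
  rewrite -(ler_pM2l a0) (le_trans (Mge _)) // Jmid.
  move: (uP p) (uP q) (Jm ((2^-1)%:C *: (u p + u q))) pN qN.
  move: (a * e ^+ 2) p.+1%:R^-1 q.+1%:R^-1 (J _) (J (u p)) (J (u q)).
  by move=> *; lra.
exists l => h; apply/esym/eqP; rewrite -subr_eq0; apply/eqP.
apply: (@quadratic_ge0_eq0 (rin (M h) h)) => [|t].
  by rewrite (le_trans _ (Mge h)) // mulr_ge0 ?sqr_ge0 ?ltW.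
(* The first variation at [l] is reached through [u n]: [m <= J (u n + t h)] and
   [J (u n) < m + 1/(n+1)], and the limit enters only in the term linear in [t]. Each of the two
   errors costs [e / 2]. *)
suff key (e : R) : 0 < e ->
    0 <= e + (t ^+ 2 * rin (M h) h + 2 * t * (rin h (M l) - f h)).
  by apply/ler_addgt0Pl => e; exact: key.
move=> e0; have d0 : 0 < e / 2 by rewrite divr_gt0.
have k0 : 0 < 2 * `|t| * nm (M h) + 1.
  by rewrite ltr_wpDl // !mulr_ge0 ?nm_ge0.
have [N1 N1P] := natinv_le d0; have [N2 N2P] := ul _ (divr_gt0 d0 k0).
set n := maxn N1 N2.
have h1 := N1P n (leq_maxl _ _); have {N2P} := N2P n (leq_maxr _ _).
rewrite ler_pdivlMr // => h2.
have := Jm (u n + t%:C *: h); rewrite JD; have := uP n.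
have : 2 * t * (rin (M (u n)) h - rin h (M l)) <= e / 2.
  rewrite (rinC h) -rinBl -bopB_arg Msym.
  rewrite (le_trans (ler_norm _)) // !normrM ger0_norm //.
  apply: (le_trans _ h2); rewrite mulrDr mulr1 ler_wpDr ?nm_ge0 //.
  rewrite (le_trans (ler_wpM2l _ (rin_abs _ _))) ?mulr_ge0 //; lra.
  by move: h1; move: (n.+1%:R^-1) (J _) => v j; lra.
Qed.

End Coercive.

(** * Adjoints and spectrum *)

Section Spectrum.
Local Open Scope complex_scope.
Variables (R : realType) (H : hilbertType R).
Implicit Types (x y z : H) (a : R) (c : R[i]) (S T : bop H).

Lemma conjc_i : conjc 'i = - 'i :> R[i].
Proof. by apply/eqP; rewrite eq_complex /= oppr0 !eqxx. Qed.

Lemma rin_conjZ c x y : rin (conjc c *: x) y = rin x (c *: y).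
Proof.
rewrite /rin linearZl_LR /= (innerC x (c *: y)) linearZl_LR /= (innerC y x).
case: c (inner x y) => [u v] [w t] /=; ring.
Qed.

Lemma rin_Zconj c x y : rin (c *: x) y = rin x (conjc c *: y).
Proof. by rewrite -rin_conjZ conjcK. Qed.

(** Linearity follows by testing against every vector. The bound comes from
    [nm (S x) ^+ 2 = rin (T (S x)) x], where one factor [nm (S x)] cancels. *)
Lemma bop_of_rin (T : bop H) (S : H -> H) :
  (forall x y, rin (T x) y = rin x (S y)) -> exists S' : bop H, S' =1 S.
Proof.
move=> TS.
have SL : linear S.
  move=> c x y; apply: rin_inj => z.
  by rewrite -TS !rinDr -!rin_conjZ -bopZ_arg !TS.
have [M M0 MT] := bop_bounded T.
have SM : bounded_linear S.
  split=> //; exists M => x; rewrite !nmE -rmorphM lecR.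
  have [->|s0] := eqVneq (nm (S x)) 0; first by rewrite mulr_ge0 ?nm_ge0.
  have ps : 0 < nm (S x) by rewrite lt_def s0 nm_ge0.
  rewrite -(ler_pM2l ps) -expr2 -rinxx -TS (le_trans (rin_le _ _)) //.
  by rewrite mulrA ler_wpM2r ?nm_ge0 // mulrC MT.
have SP : S \in @bounded_linear_pred R H by apply/asboolP.
by exists (Bop SP).
Qed.

(** Riesz representation, as [coercive_solve] for the identity operator, gives [adj T y] pointwise.
    The set defining [adj] is therefore inhabited and [xget] does not fall back to 0. *)
Lemma adjP T x y : rin (T x) y = rin x (adj T y).
Proof.
have [M M0 MT] := bop_bounded T.
have /choice[S SP] y0 : exists w, forall x, rin (T x) y0 = rin x w.
  have [| | | | | |w wP] := @coercive_solve R H 1 1 (M * nm y0)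
    (fun x => rin (T x) y0) => //.
  - by move=> x0; rewrite mul1r bop1E rinxx.
  - by move=> u v; rewrite bopD_arg rinDl.
  - by move=> t u; rewrite bopZ_arg rinZl.
  - move=> u; rewrite (le_trans (rin_abs _ _)) // mulrAC.
    by rewrite ler_wpM2r ?nm_ge0 ?MT.
  by exists w.
have [S' S'E] := @bop_of_rin T S (fun x y => SP y x).
have SE : exists S0,
    [set S : bop H | forall x y, inner (T x) y = inner x (S y)]%classic S0.
  by exists S' => u v; rewrite !innerE -bopZ_arg !S'E -!SP.
by have /= adjT := xgetPex 0 SE; rewrite /rin adjT.
Qed.

Definition invertible_op T := exists S, S * T = 1 /\ T * S = 1.

Lemma invertible_opM S T :
  invertible_op S -> invertible_op T -> invertible_op (S * T).
Proof.
move=> [S' [S1 S2]] [T' [T1 T2]]; exists (T' * S'); split.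
  by rewrite mulrA -(mulrA T') S1 mulr1.
by rewrite mulrA -(mulrA S) T2 mulr1.
Qed.

(** [T] commutes with [S * T], hence with its inverse [U], so [U * T] is an inverse of [S] on both
    sides. *)
Lemma comm_invertible_op S T :
  S * T = T * S -> invertible_op (S * T) -> invertible_op S.
Proof.
move=> ST [U [U1 U2]]; exists (U * T); split; first by rewrite -mulrA -ST.
have -> : U * T = T * U; last by rewrite mulrA.
have E : T * (S * T) = S * T * T by rewrite mulrA -ST.
by rewrite -[LHS]mulr1 -U2 mulrA -(mulrA U) E !mulrA -(mulrA U) U1 mul1r.
Qed.

(** Solving [M y = z] amounts to representing the functional [rin _ z]. Coercivity yields both
    injectivity and the bound [a^-1] on the inverse. *)
Lemma coercive_invertible (M : bop H) a :
  0 < a -> symmetric_op M -> (forall x, a * nm x ^+ 2 <= rin (M x) x) ->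
  invertible_op M.
Proof.
move=> a0 Ms Mge.
have /choice[S SP] z : exists y, M y = z.
  have [| | | | |y yP] := @coercive_solve R H M a (nm z) (fun x => rin x z) a0 => //.
  - by move=> u v; rewrite rinDl.
  - by move=> t u; rewrite rinZl.
  - by move=> u; rewrite mulrC rin_abs.
  by exists y; apply: rin_inj => u; rewrite yP.
have Mi x y : M x = M y -> x = y.
  move=> Mxy; apply/eqP; rewrite -subr_eq0; apply/eqP/nm_eq0/eqP.
  rewrite -sqrf_eq0 eq_le sqr_ge0 andbT -(pmulr_rle0 _ a0) (le_trans (Mge _)) //.
  by rewrite bopB_arg Mxy subrr rin0l.
have SL : linear S by move=> c x y; apply: Mi; rewrite bopD_arg bopZ_arg !SP.
have SM : bounded_linear S.
  split=> //; exists a^-1 => x; rewrite !nmE -rmorphM lecR ler_pdivlMl //.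
  have [->|s0] := eqVneq (nm (S x)) 0; first by rewrite mulr0 nm_ge0.
  have ps : 0 < nm (S x) by rewrite lt_def s0 nm_ge0.
  rewrite -(ler_pM2r ps) -mulrA -expr2 (le_trans (Mge _)) // SP.
  exact: rin_le.
have SPr : S \in @bounded_linear_pred R H by apply/asboolP.
exists (Bop SPr); split; apply: bopP => x; rewrite bopME //= ?SP //.
exact/Mi/SP.
Qed.

(** The product of [T - c] and [T - conjc c] is [(T - Re c)^2 + (Im c)^2], which is coercive when
    [Im c] is nonzero; its commuting factor [T - c] is then invertible. *)
Lemma spectrum_real T c : symmetric_op T -> spectrum T c -> complex.Im c = 0.
Proof.
move=> Ts Tc; apply: contrapT => /eqP c0; apply: Tc.
pose D c' := T - c' *: (1 : bop H).
have DE c' x : D c' x = T x - c' *: x by [].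
have DD c1 c2 : D c1 * D c2 = D c2 * D c1.
  apply: bopP => x; rewrite !bopME !DE !bopB_arg !bopZ_arg !scalerBr !scalerA.
  by rewrite (mulrC c1) !opprB addrACA [RHS]addrACA (addrC (- _)).
have Dadj c' x y : rin (D c' x) y = rin x (D (conjc c') y).
  by rewrite !DE rinBl rinBr Ts rin_Zconj.
have cE x : D (conjc c) x =
    T x - (complex.Re c)%:C *: x + (complex.Im c)%:C *: ('i *: x).
  rewrite DE -addrA -!scaleNr scalerA -scalerDl; congr (_ + _ *: _).
  case: (c) => u v; apply/eqP; rewrite eq_complex /= oppr0 opprK.
  by rewrite !(mulr0, mul0r, mulr1, mul1r, subr0, add0r, addr0, oppr0) !eqxx.
(* Multiplication by ['i] is skew for [rin] and commutes with [T], so the cross terms of the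
   expanded square vanish. *)
have skew x : rin (T x) ('i *: x) = 0.
  have : rin (T x) ('i *: x) = - rin (T x) ('i *: x).
    by rewrite {1}Ts bopZ_arg rinC rin_Zconj -rinNr conjc_i scaleNr.
  by lra.
suff : invertible_op (D c * D (conjc c)) by exact: comm_invertible_op.
apply: (@coercive_invertible _ (complex.Im c ^+ 2)).
- by rewrite exprn_even_gt0.
- by move=> x y; rewrite !bopME Dadj Dadj conjcK.
move=> x; rewrite bopME Dadj rinxx cE nm_sqrD nmZr.
have -> : nm ('i *: x) = nm x.
  by apply/eqP; rewrite -(eqrXn2 (n := 2)) ?nm_ge0 // -!rinxx rin_i.
rewrite exprMn real_normK ?num_real // lerDr rinZr rinBl skew rinZl.
have -> : rin x ('i *: x) = 0.
  have : rin x ('i *: x) = - rin x ('i *: x).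
    by rewrite {1}rinC rin_Zconj -rinNr conjc_i scaleNr.
  by lra.
by rewrite mulr0 subr0 !mulr0 addr0 sqr_ge0.
Qed.
End Spectrum.

(** * Polynomials in an operator *)

Section PolyCalculus.
Local Open Scope complex_scope.
Variables (R : realType) (H : hilbertType R).
Implicit Types (x y z : H) (a : R) (c : R[i]) (S T : bop H).
Implicit Types (p q : {poly R[i]}) (f g : {poly R}).

Lemma bop_scalerAl c S T : c *: (S * T) = (c *: S) * T.
Proof. exact: bopP. Qed.

Lemma bop_scalerAr c S T : c *: (S * T) = S * (c *: T).
Proof. by apply: bopP => x; rewrite bopME bopZE bopME bopZ_arg. Qed.

Lemma invertible_opZ c T : c != 0 -> invertible_op T -> invertible_op (c *: T).
Proof.
move=> c0 [S [S1 S2]]; exists (c^-1 *: S).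
rewrite -!bop_scalerAl -!bop_scalerAr !scalerA mulVf // mulfV // !scale1r.
by split.
Qed.

Lemma invertible_op1 : invertible_op (1 : bop H).
Proof. by exists 1; rewrite mulr1. Qed.

(** Complex coefficients allow splitting into linear factors; [bop_horner] is the case of real
    coefficients. *)
Definition pev (p : {poly R[i]}) T : bop H := \sum_(i < size p) p`_i *: T ^+ i.

Lemma pev_widen p T n : (size p <= n)%N -> pev p T = \sum_(i < n) p`_i *: T ^+ i.
Proof.
move=> pn; rewrite /pev (big_ord_widen n (fun i => p`_i *: T ^+ i)) //.
rewrite big_mkcond /=; apply: eq_bigr => i _; case: ltnP => // ip.
by rewrite nth_default // scale0r.
Qed.

Lemma pevD p q T : pev (p + q) T = pev p T + pev q T.
Proof.
set n := maxn (size p) (size q).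
rewrite (@pev_widen _ _ (n)) ?size_polyD //.
rewrite (@pev_widen p _ n) ?leq_maxl // (@pev_widen q _ n) ?leq_maxr //.
by rewrite -big_split /=; apply: eq_bigr => i _; rewrite coefD scalerDl.
Qed.

Lemma pevZ c p T : pev (c *: p) T = c *: pev p T.
Proof.
rewrite (@pev_widen _ _ (size p)) ?size_scale_leq // scaler_sumr.
by apply: eq_bigr => i _; rewrite coefZ scalerA.
Qed.

Lemma pevC c T : pev c%:P T = c *: (1 : bop H).
Proof.
rewrite (@pev_widen _ _ (1)) ?size_polyC_leq1 //.
by rewrite big_ord1 coefC eqxx expr0.
Qed.

Lemma pevMX p T : pev (p * 'X) T = pev p T * T.
Proof.
rewrite (@pev_widen _ _ ((size p).+1)); last first.
  by rewrite (leq_trans (size_polyMleq _ _)) // size_polyX addn2.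
rewrite big_ord_recl coefMX eqxx scale0r add0r mulr_suml.
by apply: eq_bigr => i _; rewrite coefMX /= exprSr bop_scalerAl.
Qed.

Lemma pevX T : pev 'X T = T.
Proof. by rewrite -['X]mul1r pevMX pevC scale1r mul1r. Qed.

Lemma pev_comm p T : pev p T * T = T * pev p T.
Proof.
rewrite /pev mulr_suml mulr_sumr; apply: eq_bigr => i _.
by rewrite -bop_scalerAl -bop_scalerAr -exprSr exprS.
Qed.

Lemma pevM p q T : pev (p * q) T = pev p T * pev q T.
Proof.
elim/poly_ind: p => [|p c IH].
  by rewrite mul0r /pev size_poly0 big_ord0 mul0r.
rewrite mulrDl mul_polyC mulrAC !pevD pevZ !pevMX IH pevC.
by rewrite mulrDl -mulrA pev_comm mulrA -bop_scalerAl mul1r.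
Qed.

Lemma pevXn p n T : pev (p ^+ n) T = pev p T ^+ n.
Proof.
elim: n => [|n IH]; first by rewrite !expr0 pevC scale1r.
by rewrite !exprS pevM IH.
Qed.

(** If no root of [p] lay in the spectrum, every linear factor of [pev p T], and hence the whole
    product, would be invertible. *)
Lemma pev_noninvertible p T : p != 0 -> ~ invertible_op (pev p T) ->
  exists2 c, spectrum T c & root p c.
Proof.
move=> p0 pT; have [r pE] := closed_field_poly_normal p.
apply: contrapT => nroot; apply: pT; rewrite pE pevZ.
apply: invertible_opZ; first by rewrite lead_coef_eq0.
have : {subset r <= root p}.
  by move=> c cr; rewrite -topredE /= pE rootZ ?lead_coef_eq0 // root_prod_XsubC.
elim: {pE} r => [|c r IH] rp.
  by rewrite big_nil pevC scale1r; exact: invertible_op1.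
rewrite big_cons pevM; apply: invertible_opM; last first.
  by apply: IH => d dr; apply: rp; rewrite in_cons dr orbT.
rewrite pevD pevX -polyCN pevC scaleNr; apply: contrapT => cT.
by apply: nroot; exists c => //; apply: rp; rewrite mem_head.
Qed.

Definition rpoly f : {poly R[i]} := map_poly (real_complex R) f.

Lemma horner_pev f T : bop_horner f T = pev (rpoly f) T.
Proof.
rewrite (@pev_widen _ _ (size f)) ?size_map_poly //.
by apply: eq_bigr => i _; rewrite coef_map.
Qed.

Lemma bop_hornerD f g T : bop_horner (f + g) T = bop_horner f T + bop_horner g T.
Proof. by rewrite !horner_pev /rpoly rmorphD pevD. Qed.

Lemma bop_hornerM f g T : bop_horner (f * g) T = bop_horner f T * bop_horner g T.
Proof. by rewrite !horner_pev /rpoly rmorphM pevM. Qed.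

Lemma bop_hornerXn f n T : bop_horner (f ^+ n) T = bop_horner f T ^+ n.
Proof. by rewrite !horner_pev /rpoly rmorphXn pevXn. Qed.

Lemma bop_hornerC a T : bop_horner a%:P T = a%:C *: (1 : bop H).
Proof. by rewrite horner_pev /rpoly map_polyC pevC. Qed.

Lemma bop_hornerX T : bop_horner 'X T = T.
Proof. by rewrite horner_pev /rpoly map_polyX pevX. Qed.

Lemma bop_hornerZ a f T : bop_horner (a *: f) T = a%:C *: bop_horner f T.
Proof. by rewrite -mul_polyC bop_hornerM bop_hornerC -bop_scalerAl mul1r. Qed.

Lemma bop_hornerB f g T : bop_horner (f - g) T = bop_horner f T - bop_horner g T.
Proof.
by rewrite bop_hornerD -scaleN1r bop_hornerZ rmorphN1 scaleN1r.
Qed.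

Lemma symmetric_horner f T : symmetric_op T -> symmetric_op (bop_horner f T).
Proof.
move=> Ts; elim/poly_ind: f => [|f a IH] x y.
  by rewrite -polyC0 bop_hornerC scale0r rin0l rinC rin0l.
rewrite bop_hornerD bop_hornerM bop_hornerX bop_hornerC !bopDE !bopZE !bopME.
rewrite rinDl rinDr !bop1E rinZl rinZr IH Ts; congr (rin x _ + _).
by rewrite -!bopME !horner_pev pev_comm.
Qed.

Definition positive_op T := symmetric_op T /\ forall x, 0 <= rin (T x) x.

(** For [a < 0] the operator [T - a] is coercive with constant [- a]; for [a > opnorm T] the
    operator [a - T] is, with constant [a - opnorm T]. *)
Lemma spectrum_positive T a :
  positive_op T -> spectrum T a%:C -> 0 <= a <= opnorm T.
Proof.
move=> [Ts Tp] Ta; apply/andP; split; rewrite leNgt; apply/negP => ha; apply: Ta.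
  apply: (@coercive_invertible _ _ _ (- a)); first by rewrite oppr_gt0.
    by move=> x y; rewrite !bopBE !bopZE !bop1E rinBl rinBr rinZl rinZr Ts.
  move=> x; rewrite bopBE bopZE bop1E rinBl rinZl rinxx; have := Tp x; lra.
suff /(@invertible_opZ (-1)) : invertible_op (a%:C *: (1 : bop H) - T).
  by rewrite scaleN1r opprB; apply; rewrite oppr_eq0 oner_eq0.
apply: (@coercive_invertible _ _ _ (a - opnorm T)); first by rewrite subr_gt0.
  by move=> x y; rewrite !bopBE !bopZE !bop1E rinBl rinBr rinZl rinZr Ts.
move=> x; rewrite bopBE bopZE bop1E rinBl rinZl rinxx.
by have := rin_opnorm T x; rewrite ler_norml => /andP[_]; lra.
Qed.

Lemma opnorm_sup T (e : R) : 0 < e -> 0 < opnorm T ->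
  exists2 x, nm x <= 1 & opnorm T - e < nm (T x).
Proof.
move=> e0 T0; have [_ [x /= x1 <-] xe] := sup_adherent e0 (opnorm_has_sup T).
by exists x => //; rewrite -lecR -nmE.
Qed.

(* Approximate maximisers of |T x| are approximate eigenvectors of T^2 for the
   eigenvalue |T|^2. *)
Lemma sqr_opnorm_noninvertible T : symmetric_op T -> 0 < opnorm T ->
  ~ invertible_op (T ^+ 2 - (opnorm T ^+ 2)%:C *: (1 : bop H)).
Proof.
move=> Ts T0 [S [S1 _]]; set N := opnorm T in T0 S1.
have [M M0 SM] := bop_bounded S.
pose K := M ^+ 2 * N ^+ 4.
have K0 : 0 <= K by rewrite mulr_ge0 ?exprn_ge0 // ltW.
(* An inverse bounded by [M] forces [nm x ^+ 2 <= M^2 N^2 (N^2 - |T x|^2)]. This keeps [|T x|^2]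
   below [N^2 K / (1 + K)] on the unit ball, against the definition of [N]. *)
have key x : nm x <= 1 -> nm (T x) ^+ 2 * (1 + K) <= K * N ^+ 2.
  move=> x1.
  have TTx : nm (T (T x)) ^+ 2 <= N ^+ 2 * nm (T x) ^+ 2.
    by rewrite -exprMn lerXn2r ?nnegrE ?mulr_ge0 ?nm_ge0 ?(ltW T0) // opnorm_le.
  have Tx : nm (T x) ^+ 2 <= N ^+ 2 * nm x ^+ 2.
    by rewrite -exprMn lerXn2r ?nnegrE ?mulr_ge0 ?nm_ge0 ?(ltW T0) // opnorm_le.
  have x2 : nm x ^+ 2 <= 1 by rewrite exprn_ile1 ?nm_ge0.
  have : nm x ^+ 2 <= M ^+ 2 * nm ((T ^+ 2 - (N ^+ 2)%:C *: (1 : bop H)) x) ^+ 2.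
    rewrite -exprMn lerXn2r ?nnegrE ?mulr_ge0 ?nm_ge0 //.
    by rewrite (le_trans _ (SM _)) // -bopME S1.
  rewrite bopBE bopZE bop1E expr2 bopME nm_sqrB nmZr rinZr Ts rinxx exprMn.
  rewrite real_normK ?num_real // => h.
  have h1 : nm x ^+ 2 <= M ^+ 2 * (N ^+ 2 * (N ^+ 2 - nm (T x) ^+ 2)).
    rewrite (le_trans h) // ler_wpM2l ?sqr_ge0 //.
    have : (N ^+ 2) ^+ 2 * nm x ^+ 2 <= (N ^+ 2) ^+ 2 * 1.
      by rewrite ler_wpM2l ?sqr_ge0.
    by move: TTx; rewrite mulr1; lra.
  have : N ^+ 2 * nm x ^+ 2 <=
      N ^+ 2 * (M ^+ 2 * (N ^+ 2 * (N ^+ 2 - nm (T x) ^+ 2))).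
    by rewrite ler_wpM2l ?sqr_ge0.
  have -> : N ^+ 2 * (M ^+ 2 * (N ^+ 2 * (N ^+ 2 - nm (T x) ^+ 2))) =
      K * N ^+ 2 - K * nm (T x) ^+ 2 by rewrite /K; ring.
  by move: Tx; lra.
(* With this [e], [(N - e)^2 (1 + K)] exceeds [K N^2] by exactly [e^2 (1 + K)]. *)
pose e := N / (2 * (1 + K)).
have e0 : 0 < e by rewrite divr_gt0 // mulr_gt0 //; lra.
have eK : e * (2 * (1 + K)) = N by rewrite /e divfK // gt_eqF // mulr_gt0 //; lra.
have eN : e <= N by rewrite -[leRHS]eK ler_peMr ?(ltW e0) //; lra.
have [x /key h xe] := opnorm_sup e0 T0.
have : (N - e) ^+ 2 <= nm (T x) ^+ 2.
  by rewrite lerXn2r ?nnegrE ?nm_ge0 ?subr_ge0 // ltW.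
have : (N - e) ^+ 2 * (1 + K) = N ^+ 2 * K + e ^+ 2 * (1 + K).
  have -> : (N - e) ^+ 2 * (1 + K) =
      N ^+ 2 * (1 + K) - N * (e * (2 * (1 + K))) + e ^+ 2 * (1 + K) by ring.
  by rewrite eK; ring.
have : 0 < e ^+ 2 * (1 + K) by rewrite mulr_gt0 ?exprn_gt0 //; lra.
have : 0 < 1 + K by lra.
move=> k1 h1 h2 h3; have : (N - e) ^+ 2 * (1 + K) <= nm (T x) ^+ 2 * (1 + K).
  by rewrite ler_pM2r.
lra.
Qed.

End PolyCalculus.

(** * The spectral bound *)

Section SpectralBound.
Local Open Scope complex_scope.
Variables (R : realType) (H : hilbertType R).
Implicit Types (x y z : H) (a : R) (c : R[i]) (S T : bop H) (f g : {poly R}).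

Lemma noninvertible_root T f : symmetric_op T -> f != 0 ->
  ~ invertible_op (bop_horner f T) -> exists2 a, spectrum T a%:C & root f a.
Proof.
move=> Ts f0; rewrite horner_pev => /pev_noninvertible[].
  by rewrite /rpoly map_poly_eq0.
move=> [a b] Tc; have /= b0 := spectrum_real Ts Tc; rewrite b0 in Tc *.
rewrite complexr0 in Tc * => fa; exists a => //.
by rewrite -(fmorph_root (real_complex R)).
Qed.

Lemma opnorm_eq0 T : opnorm T = 0 -> T = 0.
Proof. by move=> T0; apply: bop_nmB_eq0 => e e0; rewrite subr0 T0 ltW. Qed.

Lemma spectrum_nonempty T : symmetric_op T -> (1 : bop H) <> 0 ->
  exists a, spectrum T a%:C.
Proof.
move=> Ts H0; suff [f f0 fT] : exists2 f, f != 0 & ~ invertible_op (bop_horner f T).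
  by have [a aT _] := noninvertible_root Ts f0 fT; exists a.
have [T0|T0] := eqVneq (opnorm T) 0.
  exists 'X; first by rewrite polyX_eq0.
  rewrite bop_hornerX (opnorm_eq0 T0) => -[S [S1 _]].
  by apply: H0; rewrite -S1 mulr0.
exists ('X ^+ 2 - (opnorm T ^+ 2)%:P).
  by rewrite -size_poly_eq0 size_XnsubC.
rewrite bop_hornerB bop_hornerXn bop_hornerX bop_hornerC.
by apply: sqr_opnorm_noninvertible => //; rewrite lt_def T0 opnorm_ge0.
Qed.

Lemma opnorm_horner_spectrum T f : symmetric_op T -> 0 < opnorm (bop_horner f T) ->
  exists2 a, spectrum T a%:C & opnorm (bop_horner f T) ^+ 2 = f.[a] ^+ 2.
Proof.
move=> Ts; set N := opnorm _ => N0.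
have gE a : (f ^+ 2 - (N ^+ 2)%:P).[a] = f.[a] ^+ 2 - N ^+ 2.
  by rewrite hornerD hornerN hornerC horner_exp.
(* If [f ^+ 2] is the constant [N ^+ 2], any spectral point will do; one exists because [0 < N]
   rules out the zero space. *)
have [g0|g0] := eqVneq (f ^+ 2 - (N ^+ 2)%:P) 0.
  have [|a aT] := spectrum_nonempty Ts.
    move=> H0; move: N0; rewrite /N -[bop_horner f T]mulr1 H0 mulr0.
    rewrite lt_neqAle eq_le opnorm_ge0 andbT (opnorm_lub (a := 0)) // => x.
    by rewrite nm0 mul0r.
  by exists a => //; apply/eqP; rewrite eq_sym -subr_eq0 -gE g0 horner0.
have [|a aT] := noninvertible_root Ts g0.
  rewrite bop_hornerB bop_hornerXn bop_hornerC.
  by apply: sqr_opnorm_noninvertible => //; exact: symmetric_horner.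
rewrite /root gE subr_eq0 => /eqP fa.
by exists a.
Qed.

Lemma opnorm_horner_le T f a : symmetric_op T -> 0 <= a ->
  (forall t, spectrum T t%:C -> `|f.[t]| <= a) -> opnorm (bop_horner f T) <= a.
Proof.
move=> Ts a0 fa; have [N0|N0] := eqVneq (opnorm (bop_horner f T)) 0.
  by rewrite N0.
have {N0} : 0 < opnorm (bop_horner f T) by rewrite lt_def N0 opnorm_ge0.
move=> /(opnorm_horner_spectrum Ts)[t /fa ft fE].
rewrite -(ler_pXn2r (n := 2)) ?nnegrE ?opnorm_ge0 // fE.
rewrite -(real_normK (num_real f.[t])) ler_pXn2r ?nnegrE ?normr_ge0 //.
Qed.

(** On the spectrum [f] is within [|a| / 2] of [|a| / 2], so the same holds in operator norm. The
    absolute value covers a possibly empty spectrum, where [a] may be negative. *)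
Lemma horner_ge0 T f a : symmetric_op T ->
  (forall t, spectrum T t%:C -> 0 <= f.[t] <= a) ->
  forall x, 0 <= rin (bop_horner f T x) x.
Proof.
move=> Ts fa x.
have a0 : 0 <= `|a| / 2 by rewrite divr_ge0.
have : opnorm (bop_horner (f - (`|a| / 2)%:P) T) <= `|a| / 2.
  apply: opnorm_horner_le => // t /fa /andP[f0 f1].
  rewrite hornerD hornerN hornerC ler_distl; have := ler_norm a; lra.
rewrite bop_hornerB bop_hornerC => h.
have := rin_opnorm (bop_horner f T - (`|a| / 2)%:C *: (1 : bop H)) x.
rewrite bopBE bopZE bop1E rinBl rinZl rinxx ler_norml => /andP[+ _].
have := ler_wpM2r (sqr_ge0 (nm x)) h; lra.
Qed.

End SpectralBound.

(** * Polynomial approximation of real powers *)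

Section Approximation.
Variable R : realType.
Implicit Types (a s t u x y : R) (g h : nat -> R).

(** For [s > 1] this is Young's inequality for [u] and [a ^ (s - 1)] with conjugate exponents [s]
    and [s / (s - 1)]. *)
Lemma powR_tangent s a u : 1 <= s -> 0 <= a -> 0 <= u ->
  a `^ s + s * a `^ (s - 1) * (u - a) <= u `^ s.
Proof.
rewrite le_eqVlt => /predU1P[<-|s1] a0 u0.
  by rewrite subrr powRr0 !powRr1 // !mul1r addrC subrK.
have s0 : 0 < s by lra.
have q0 : 0 < s / (s - 1) by rewrite divr_gt0 //; lra.
have := conjugate_powR u0 (powR_ge0 a (s - 1)) s0 q0.
rewrite -powRrM mulrCA mulfV ?mulr1; last by rewrite subr_eq0 gt_eqF.
have -> : s^-1 + (s / (s - 1))^-1 = 1.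
  by field; rewrite subr_eq0 !gt_eqF.
move=> /(_ erefl); rewrite -(ler_pM2l s0) => h.
have : s * (u `^ s / s + a `^ s / (s / (s - 1))) = u `^ s + (s - 1) * a `^ s.
  by field; rewrite subr_eq0 !gt_eqF.
by have := mulr_powRB1 a0 s0; move: h; nra.
Qed.

Lemma powR_midpoint s a u : 1 <= s -> 0 <= a -> 0 <= u ->
  ((a + u) / 2) `^ s <= (a `^ s + u `^ s) / 2.
Proof.
move=> s1 a0 u0; have m0 : 0 <= (a + u) / 2 by rewrite divr_ge0 ?addr_ge0.
(* The slope terms of the tangent at the midpoint cancel in the sum. *)
have := powR_tangent s1 m0 a0; have := powR_tangent s1 m0 u0.
lra.
Qed.

(* [bern n g] evaluated at x is the expectation of g under the binomial
   distribution with parameters n and x; the recursion conditions on the first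
   trial. *)
Fixpoint bern n g : {poly R} :=
  if n is n'.+1 then 'X * bern n' (fun k => g k.+1) + (1 - 'X) * bern n' g
  else (g 0%N)%:P.

Lemma bernS n g x :
  (bern n.+1 g).[x] = x * (bern n (fun k => g k.+1)).[x] + (1 - x) * (bern n g).[x].
Proof. by rewrite /= !hornerE. Qed.

Lemma bern_le n g h x : 0 <= x <= 1 -> (forall k, (k <= n)%N -> g k <= h k) ->
  (bern n g).[x] <= (bern n h).[x].
Proof.
move=> /andP[x0 x1]; elim: n g h => [|n IH] g h gh; first by rewrite !hornerC gh.
rewrite !bernS lerD // ler_wpM2l ?subr_ge0 //; apply: IH => k kn; apply: gh => //.
exact: leqW.
Qed.

(** The mean squared distance to [c] is the binomial variance plus the squared bias. A success in
    the first trial shifts [c] to [c - 1]. *)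
Lemma bern_variance n a u c x :
  (bern n (fun k => a + u * (k%:R - c) ^+ 2)).[x] =
  a + u * (n%:R * x * (1 - x) + (n%:R * x - c) ^+ 2).
Proof.
elim: n c => [|n IH] c; first by rewrite hornerC; ring.
rewrite bernS IH.
have -> : (fun k => a + u * (k.+1%:R - c) ^+ 2) =
    (fun k => a + u * (k%:R - (c - 1)) ^+ 2).
  by apply/funext => k; rewrite -natr1; ring.
by rewrite IH -natr1; ring.
Qed.

(** Bernstein's argument: the quadratic modulus bounds [f (k/m) - f x] pointwise, and averaging
    turns the square into the variance [x (1 - x) / m]. The degree [n.+1] keeps [m] nonzero. *)
Lemma bern_approx (f : R -> R) n e K x : 0 <= K -> 0 <= x <= 1 ->
  (forall y t, 0 <= y <= 1 -> 0 <= t <= 1 -> `|f y - f t| <= e + K * (y - t) ^+ 2) ->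
  `|(bern n.+1 (fun k => f (k%:R / n.+1%:R))).[x] - f x| <= e + K / n.+1%:R.
Proof.
move=> K0 x01 fK; set m : R := n.+1%:R.
have m0 : 0 < m by rewrite ltr0n.
have kE k : K * (k%:R / m - x) ^+ 2 = K / m ^+ 2 * (k%:R - m * x) ^+ 2.
  by clearbody m; field; rewrite gt_eqF.
have dev k : (k <= n.+1)%N ->
    `|f (k%:R / m) - f x| <= e + K / m ^+ 2 * (k%:R - m * x) ^+ 2.
  move=> kn; rewrite -kE; apply: fK => //.
  by rewrite divr_ge0 ?(ltW m0) ?ler0n //= ler_pdivrMr // mul1r ler_nat.
have var : K / m ^+ 2 * (m * x * (1 - x)) <= K / m.
  have -> : K / m ^+ 2 * (m * x * (1 - x)) = K / m * (x * (1 - x)).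
    by clearbody m; field; rewrite gt_eqF.
  rewrite ler_piMr ?divr_ge0 ?(ltW m0) //.
  by move/andP: x01 => [x0 x1]; nra.
set g : nat -> R := fun k => f (k%:R / m).
have up : (bern n.+1 g).[x] <= f x + e + K / m ^+ 2 * (m * x * (1 - x)).
  pose h (k : nat) := f x + e + K / m ^+ 2 * (k%:R - m * x) ^+ 2.
  apply: (le_trans (@bern_le _ _ h _ x01 _)).
    move=> k /dev; rewrite /g /h; move: (K / m ^+ 2 * _) => w.
    by rewrite ler_norml => /andP[_]; lra.
  by rewrite bern_variance -/m subrr expr0n /= addr0.
have lo : f x - e - K / m ^+ 2 * (m * x * (1 - x)) <= (bern n.+1 g).[x].
  pose h (k : nat) := f x - e + - (K / m ^+ 2) * (k%:R - m * x) ^+ 2.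
  apply: (le_trans _ (@bern_le _ h _ _ x01 _)).
    by rewrite bern_variance -/m subrr expr0n /= addr0 mulNr.
  move=> k /dev; rewrite /g /h mulNr; move: (K / m ^+ 2 * _) => w.
  by rewrite ler_norml => /andP[+ _]; lra.
rewrite ler_distl; move: up lo var.
move: (K / m ^+ 2 * _) (K / m) (_.[x]) => w1 w2 w3 up lo var.
by apply/andP; split; lra.
Qed.

Lemma poly_approx (f : R -> R) (N : R) : 0 < N ->
  (forall e, 0 < e -> exists2 K, 0 <= K & forall y t, 0 <= y <= N -> 0 <= t <= N ->
     `|f y - f t| <= e + K * (y - t) ^+ 2) ->
  forall e, 0 < e -> exists p : {poly R},
    forall t, 0 <= t <= N -> `|p.[t] - f t| <= e.
Proof.
move=> N0 fK e e0; have [K K0 {}fK] := fK _ (divr_gt0 e0 (ltr0n R 2)).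
(* Rescaling [[0, N]] to [[0, 1]] multiplies [K] by [N ^+ 2]; this [n] makes the variance error at
   most [e / 2]. *)
pose n := Num.truncn (K * N ^+ 2 / (e / 2)).
exists (bern n.+1 (fun k => f (N * (k%:R / n.+1%:R))) \Po (N^-1 *: 'X)).
move=> t /andP[t0 tN].
rewrite horner_comp hornerZ hornerX.
have tE : N * (N^-1 * t) = t by rewrite mulrA mulfV ?mul1r // gt_eqF.
have K1 : 0 <= K * N ^+ 2 by rewrite mulr_ge0 ?sqr_ge0.
have := @bern_approx (fun x => f (N * x)) n (e / 2) (K * N ^+ 2) (N^-1 * t) K1.
rewrite tE => h; apply: (le_trans (h _ _)).
- by rewrite mulr_ge0 ?invr_ge0 ?(ltW N0) //= ler_pdivrMl // mulr1.
- move=> y u /andP[y0 y1] /andP[u0 u1].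
  rewrite -mulrA -exprMn mulrBr; apply: fK.
    by rewrite mulr_ge0 ?(ltW N0) //= ler_piMr // ltW.
  by rewrite mulr_ge0 ?(ltW N0) //= ler_piMr // ltW.
rewrite [leRHS]splitr lerD2l.
have := ltW (truncnS_gt (K * N ^+ 2 / (e / 2))).
by rewrite -/n ler_pdivrMr ?divr_gt0 // ler_pdivrMr ?ltr0n // (mulrC (e / 2)).
Qed.

(** The tangent inequality gives the Lipschitz constant [L] on [[0, N]], and
    [2 L d <= e + L^2 d^2 / e] makes the bound quadratic. *)
Lemma powR_modulus s (N : R) : 1 <= s -> 0 < N -> forall e, 0 < e ->
  exists2 K, 0 <= K & forall y t, 0 <= y <= N -> 0 <= t <= N ->
     `|y `^ s - t `^ s| <= e + K * (y - t) ^+ 2.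
Proof.
move=> s1 N0 e e0; pose L := s * N `^ (s - 1).
have L0 : 0 <= L by rewrite mulr_ge0 ?powR_ge0 //; lra.
exists (L ^+ 2 / e); first by rewrite divr_ge0 ?sqr_ge0 ?ltW.
have key y t : 0 <= y <= N -> 0 <= t <= N ->
    y `^ s - t `^ s <= e + L ^+ 2 / e * (y - t) ^+ 2.
  move=> /andP[y0 yN] /andP[t0 tN].
  have h := powR_tangent s1 y0 t0.
  have h1 : y `^ (s - 1) <= N `^ (s - 1).
    by rewrite ge0_ler_powR ?nnegrE ?subr_ge0 // ltW.
  have h2 : s * y `^ (s - 1) * (y - t) <= L * `|y - t|.
    rewrite (le_trans (ler_norm _)) // normrM ler_wpM2r // ger0_norm.
      by rewrite ler_wpM2l //; lra.
    by rewrite mulr_ge0 ?powR_ge0 //; lra.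
  rewrite -(real_normK (num_real (y - t))); set d := `|y - t| in h2 *.
  have : 0 <= (L * d - e) ^+ 2 / e by rewrite divr_ge0 ?sqr_ge0 // ltW.
  have -> : (L * d - e) ^+ 2 / e = L ^+ 2 / e * d ^+ 2 - 2 * (L * d) + e.
    by field; rewrite gt_eqF.
  have : 0 <= L ^+ 2 / e * d ^+ 2.
    by rewrite mulr_ge0 ?sqr_ge0 // divr_ge0 ?sqr_ge0 // ltW.
  lra.
move=> y t yN tN; rewrite ler_norml; apply/andP; split; last exact: key.
by have := key _ _ tN yN; rewrite -(sqrrN (t - y)) opprB; lra.
Qed.

(** The difference [d] of the roots satisfies [d^4 <= (y - t)^2]. Either [d <= e], or
    [d <= d^4 / e^3]. *)
Lemma sqrt_modulus e : 0 < e ->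
  exists2 K, 0 <= K & forall y t, 0 <= y -> 0 <= t ->
     `|y `^ 2^-1 - t `^ 2^-1| <= e + K * (y - t) ^+ 2.
Proof.
move=> e0; exists (e ^- 3); first by rewrite invr_ge0 exprn_ge0 // ltW.
move=> y t y0 t0; rewrite !powR12_sqrt //.
set d := `|_ - _|; have d0 : 0 <= d by rewrite normr_ge0.
have h : d ^+ 4 <= (y - t) ^+ 2.
  rewrite -{1}(sqr_sqrtr y0) -{1}(sqr_sqrtr t0) subr_sqr exprMn.
  rewrite (exprD _ 2 2) !real_normK ?num_real // ler_wpM2l ?sqr_ge0 //.
  by have := mulr_ge0 (sqrtr_ge0 y) (sqrtr_ge0 t); lra.
have [de|/ltW de] := leP d e.
  by rewrite (le_trans de) // lerDl mulr_ge0 ?sqr_ge0 // invr_ge0 exprn_ge0 // ltW.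
rewrite (@le_trans _ _ (e ^- 3 * d ^+ 4)) //.
  rewrite ler_pdivlMl ?exprn_gt0 // (exprSr d 3) ler_wpM2r //.
  by rewrite lerXn2r ?nnegrE // ltW.
by rewrite ler_wpDl ?(ltW e0) // ler_wpM2l // invr_ge0 exprn_ge0 // ltW.
Qed.
End Approximation.

(** * Functional calculus *)

Section FunctionalCalculus.
Local Open Scope complex_scope.
Variables (R : realType) (H : hilbertType R).
Implicit Types (x y z : H) (a e t : R) (c : R[i]) (S T X : bop H) (p q : {poly R}).

Lemma bop_complete (P : nat -> bop H) :
  (forall e, 0 < e -> exists N, forall m n, (N <= m)%N -> (N <= n)%N ->
    opnorm (P m - P n) <= e) ->
  exists X, forall e, 0 < e -> exists N, forall n, (N <= n)%N ->
    opnorm (P n - X) <= e.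
Proof.
move=> PC.
have /choice[X XP] x : exists l, forall e, 0 < e -> exists N, forall n,
    (N <= n)%N -> nm (P n x - l) <= e.
  apply: nm_complete => e e0.
  have k0 : 0 < nm x + 1 by rewrite ltr_wpDl ?nm_ge0.
  have [N NP] := PC _ (divr_gt0 e0 k0); exists N => m n Nm Nn.
  rewrite -bopBE (le_trans (opnorm_le _ _)) //.
  rewrite (le_trans (ler_wpM2r (nm_ge0 x) (NP _ _ Nm Nn))) //.
  by rewrite mulrAC ler_pdivrMr // ler_wpM2l ?ltW // ltrDl.
(* Comparing with a late [P m x] makes the pointwise convergence uniform relative to [nm x];
   linearity and boundedness of the limit follow from it. *)
have key e : 0 < e ->
    exists N, forall n x, (N <= n)%N -> nm (P n x - X x) <= e * nm x.
  move=> e0; have [N NP] := PC _ e0; exists N => n x Nn.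
  apply/ler_addgt0Pr => d d0; have [M MP] := XP x _ d0.
  set m := maxn N M.
  have -> : P n x - X x = (P n - P m) x + (P m x - X x).
    by rewrite bopBE addrA subrK.
  rewrite (le_trans (ler_nmD _ _)) // lerD ?MP ?leq_maxr //.
  rewrite (le_trans (opnorm_le _ _)) // ler_wpM2r ?nm_ge0 //.
  by rewrite NP // leq_maxl.
have XL : linear X.
  move=> c x y; apply/eqP; rewrite -subr_eq0; apply/eqP/nm_eq0/eqP.
  rewrite eq_le nm_ge0 andbT; apply/ler_addgt0Pr => d d0; rewrite add0r.
  set k := nm (c *: x + y) + complex.Re `|c| * nm x + nm y + 1.
  have cx : 0 <= complex.Re `|c| * nm x by rewrite -nmZ nm_ge0.
  have k0 : 0 < k by rewrite ltr_wpDl // !addr_ge0 ?nm_ge0.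
  have [N NP] := key _ (divr_gt0 d0 k0).
  have -> : X (c *: x + y) - (c *: X x + X y) =
      - (P N (c *: x + y) - X (c *: x + y)) + c *: (P N x - X x) + (P N y - X y).
    rewrite bopD_arg bopZ_arg scalerBr opprB -!addrA; congr (_ + _).
    by rewrite [in RHS](addrA (c *: P N x)) addrACA addKr opprD.
  rewrite (le_trans (ler_nmD _ _)) // (le_trans (lerD (ler_nmD _ _) (lexx _))) //.
  rewrite nmN nmZ.
  have h1 := NP N (c *: x + y) (leqnn _).
  have h2 := NP N y (leqnn _).
  have h3 : complex.Re `|c| * nm (P N x - X x) <= complex.Re `|c| * (d / k * nm x).
    by rewrite ler_wpM2l ?NP // -ler0c RRe_real ?normr_real.
  have : d / k * k = d by rewrite divfK // gt_eqF.
  have : 0 < d / k by rewrite divr_gt0.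
  by move: h1 h2 h3; move: (d / k) => w; rewrite /k; lra.
have [N NP] := key 1 ltr01.
have XB : bounded_linear X.
  split=> //; exists (opnorm (P N) + 1) => x; rewrite !nmE -rmorphM lecR.
  have -> : X x = P N x - (P N x - X x) by rewrite opprB addrCA subrr addr0.
  rewrite (le_trans (ler_nmD _ _)) // nmN mulrDl lerD ?opnorm_le //.
  exact: NP.
have Xin : X \in @bounded_linear_pred R H by apply/asboolP.
exists (Bop Xin) => e e0; have [M MP] := key _ e0; exists M => n Mn.
by apply: opnorm_lub => [|x]; [exact: ltW|exact: MP].
Qed.

Lemma opnorm_hornerB_le T p q e : symmetric_op T -> 0 <= e ->
  (forall t, spectrum T t%:C -> `|p.[t] - q.[t]| <= e) ->
  opnorm (bop_horner p T - bop_horner q T) <= e.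
Proof.
move=> Ts e0 pq; rewrite -bop_hornerB; apply: opnorm_horner_le => // t /pq.
by rewrite hornerD hornerN.
Qed.

(** Polynomials within [1/(n+1)] of [f] on the spectrum have Cauchy values at [T] by
    [opnorm_horner_le]. Their limit inhabits the set in [cfc], so the default 0 is avoided. *)
Lemma cfc_exists (f : R -> R) T : symmetric_op T ->
  (forall e, 0 < e -> exists p : {poly R},
     forall t, spectrum T t%:C -> `|p.[t] - f t| <= e) ->
  is_cfc f T (cfc f T).
Proof.
move=> Ts fp; suff fE : exists X, [set X | is_cfc f T X]%classic X.
  exact: (xgetPex 0 fE).
have /choice[p pP] n : exists p : {poly R},
    forall t, spectrum T t%:C -> `|p.[t] - f t| <= n.+1%:R^-1.
  by apply: fp; rewrite invr_gt0 ltr0n.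
have [e e0|X XP] := @bop_complete (fun n => bop_horner (p n) T).
  have [N NP] := natinv_le (divr_gt0 e0 (ltr0n R 2)).
  exists N => m n /NP mN /NP nN.
  apply: opnorm_hornerB_le => [//||t tT]; first exact: ltW.
  rewrite -(subrKA (f t)) (le_trans (ler_normD _ _)) // (splitr e) lerD //.
    by rewrite (le_trans (pP _ _ tT)).
  by rewrite distrC (le_trans (pP _ _ tT)).
exists X => e e0; have [N NP] := natinv_le e0; have [M MP] := XP _ e0.
exists (p (maxn N M)); split => [t tT|]; last by rewrite MP // leq_maxr.
by rewrite (le_trans (pP _ _ tT)) // NP // leq_maxl.
Qed.

Lemma cfc_symmetric (f : R -> R) T X :
  symmetric_op T -> is_cfc f T X -> symmetric_op X.
Proof.
move=> Ts XP x y; apply/eqP; rewrite -subr_eq0 -normr_eq0 eq_le normr_ge0 andbT.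
apply/ler_addgt0Pr => d d0; rewrite add0r.
set k := 2 * nm x * nm y + 1.
have k0 : 0 < k by rewrite ltr_wpDl // !mulr_ge0 ?nm_ge0.
have [p [_ pX]] := XP _ (divr_gt0 d0 k0).
set P := bop_horner p T in pX.
have Ps : symmetric_op P by exact: symmetric_horner.
have -> : rin (X x) y - rin x (X y) = rin x ((P - X) y) - rin ((P - X) x) y.
  by rewrite !bopBE rinBl rinBr Ps; ring.
rewrite (le_trans (ler_normB _ _)) //.
have h (u v : H) : nm u * nm ((P - X) v) <= d / k * (nm u * nm v).
  rewrite mulrCA ler_wpM2l ?nm_ge0 // (le_trans (opnorm_le _ _)) //.
  by rewrite ler_wpM2r ?nm_ge0.
have h1 := le_trans (rin_abs _ _) (h x y).
have h2 : `|rin ((P - X) x) y| <= d / k * (nm y * nm x).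
  by rewrite rinC (le_trans (rin_abs _ _)).
have : d / k * k = d by rewrite divfK // gt_eqF.
have : 0 < d / k by rewrite divr_gt0.
by move: h1 h2; move: (d / k) => w; rewrite /k; lra.
Qed.

Lemma poly_bounded p (N : R) : exists a, forall t, 0 <= t <= N -> p.[t] <= a.
Proof.
suff [a ap] : exists a, forall t, 0 <= t <= N -> `|p.[t]| <= a.
  by exists a => t /ap; exact: le_trans (ler_norm _).
elim/poly_ind: p => [|p b [a ap]].
  by exists 0 => t _; rewrite horner0 normr0.
exists (a * N + `|b|) => t tN; rewrite hornerMXaddC (le_trans (ler_normD _ _)) //.
rewrite lerD // normrM ler_pM ?ap //.
by case/andP: tN => t0 tN; rewrite ger0_norm.
Qed.

(** The upper bound required by [horner_ge0] comes from boundedness of [p] on [[0, opnorm T]], which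
    contains the spectrum. *)
Lemma positive_horner T p : positive_op T ->
  (forall t, spectrum T t%:C -> 0 <= p.[t]) ->
  forall x, 0 <= rin (bop_horner p T x) x.
Proof.
move=> Tp p0; have [a ap] := poly_bounded p (opnorm T).
apply: (@horner_ge0 _ _ _ _ a); first by case: Tp.
by move=> t tT; rewrite p0 //= ap // spectrum_positive.
Qed.

Lemma cfc_ge (f : R -> R) T X q : positive_op T -> is_cfc f T X ->
  (forall t, spectrum T t%:C -> q.[t] <= f t) ->
  forall x, rin (bop_horner q T x) x <= rin (X x) x.
Proof.
move=> Tp XP qf x; apply/ler_addgt0Pr => d d0.
set k := 2 * nm x ^+ 2 + 1.
have k0 : 0 < k by rewrite ltr_wpDl // mulr_ge0 ?sqr_ge0.
have [p [pf pX]] := XP _ (divr_gt0 d0 k0).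
(* Adding the approximation error [d / k] lifts [p] above [f], hence above [q], on the spectrum. The
   factor 2 in [k] pays for this error and for that of [p(T)] against [X]. *)
have := @positive_horner T (p + (d / k)%:P - q) Tp _ x.
rewrite bop_hornerB bop_hornerD bop_hornerC bopBE bopDE bopZE bop1E.
rewrite rinBl rinDl rinZl rinxx => h.
have {}h : 0 <=
    rin (bop_horner p T x) x + d / k * nm x ^+ 2 - rin (bop_horner q T x) x.
  apply: h => t tT; rewrite !hornerE; have := qf _ tT; have := pf _ tT.
  by rewrite ler_norml => /andP[]; lra.
have : rin (bop_horner p T x) x - rin (X x) x <= d / k * nm x ^+ 2.
  rewrite -rinBl (le_trans (ler_norm _)) // (le_trans (rin_opnorm (_ - _) _)) //.
  by rewrite ler_wpM2r ?sqr_ge0.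
have : d / k * k = d by rewrite divfK // gt_eqF.
have : 0 < d / k by rewrite divr_gt0.
by move: h; move: (d / k) => w; rewrite /k; lra.
Qed.

End FunctionalCalculus.

(** * Powers of positive operators *)

Section Powers.
Local Open Scope complex_scope.
Variables (R : realType) (H : hilbertType R).
Implicit Types (x y z : H) (a e s t : R) (c : R[i]).
Implicit Types (A B S T X : bop H) (p q : {poly R}).

Lemma bop_powRP_ge1 s T : 1 <= s -> positive_op T ->
  is_cfc (fun t => t `^ s) T (bop_powR T s).
Proof.
move=> s1 Tp; apply: cfc_exists => [|e e0]; first by case: Tp.
(* The added 1 keeps the approximation interval nondegenerate when [T] is 0. *)
have N0 : 0 < opnorm T + 1 by rewrite ltr_wpDl ?opnorm_ge0.
have [p pP] := poly_approx N0 (powR_modulus s1 N0) e0.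
exists p => t /(spectrum_positive Tp)/andP[t0 tT]; apply: pP.
by rewrite t0 /= (le_trans tT) // lerDl.
Qed.

Lemma bop_powRP_half T : positive_op T ->
  is_cfc (fun t => t `^ 2^-1) T (bop_powR T 2^-1).
Proof.
move=> Tp; apply: cfc_exists => [|e e0]; first by case: Tp.
have N0 : 0 < opnorm T + 1 by rewrite ltr_wpDl ?opnorm_ge0.
have [d d0|p pP] := @poly_approx _ (fun t => t `^ 2^-1) _ N0 _ e e0.
  have [K K0 KP] := sqrt_modulus d0; exists K => // y t /andP[y0 _] /andP[t0 _].
  exact: KP.
exists p => t /(spectrum_positive Tp)/andP[t0 tT]; apply: pP.
by rewrite t0 /= (le_trans tT) // lerDl.
Qed.

Lemma bop_powR_half_positive T : positive_op T -> positive_op (bop_powR T 2^-1).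
Proof.
move=> Tp; have Th := bop_powRP_half Tp; split.
  by apply: cfc_symmetric Th; case: Tp.
move=> x; have := @cfc_ge _ _ _ _ _ 0%:P Tp Th _ x.
rewrite bop_hornerC scale0r rin0l; apply => t _.
by rewrite hornerC powR_ge0.
Qed.

Lemma bop_powR_half_sqr T : positive_op T -> bop_powR T 2^-1 * bop_powR T 2^-1 = T.
Proof.
move=> Tp; have Th := bop_powRP_half Tp; set S := bop_powR T 2^-1 in Th *.
have [Ts _] := Tp.
apply: bop_nmB_eq0 => d d0.
pose N := Num.sqrt (opnorm T); have N0 : 0 <= N by exact: sqrtr_ge0.
pose k := 2 * opnorm S + 2 * N + 2.
have k0 : 0 < k by rewrite ltr_wpDl // addr_ge0 // mulr_ge0 ?opnorm_ge0.
(* The two errors [e (e + 2 N)] and [e (2 |S| + e)] add up to at most [e * k] once [e <= 1]; [N]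
   bounds the square root on the spectrum. *)
pose e := Num.min 1 (d / k).
have e0 : 0 < e by rewrite lt_min ltr01 divr_gt0.
have e1 : e <= 1 by rewrite ge_min lexx.
have ek : e * k <= d by rewrite -ler_pdivlMr // ge_min lexx orbT.
have [p [pf pS]] := Th _ e0; set Q := bop_horner p T in pS.
have QT : opnorm (Q * Q - T) <= e * (e + 2 * N).
  rewrite /Q -bop_hornerM -{2}(bop_hornerX T) opnorm_hornerB_le //.
    by rewrite mulr_ge0 ?addr_ge0 ?mulr_ge0 ?(ltW e0).
  move=> t tT; have /andP[t0 tN] := spectrum_positive Tp tT.
  have := pf _ tT; rewrite powR12_sqrt // hornerM hornerX => h.
  have sN : Num.sqrt t <= N by rewrite ler_wsqrtr.
  have -> : p.[t] * p.[t] - t = p.[t] ^+ 2 - Num.sqrt t ^+ 2.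
    by rewrite sqr_sqrtr.
  rewrite subr_sqr normrM ler_pM //.
  have -> : p.[t] + Num.sqrt t = (p.[t] - Num.sqrt t) + 2 * Num.sqrt t by ring.
  rewrite (le_trans (ler_normD _ _)) // lerD // ger0_norm ?mulr_ge0 ?sqrtr_ge0 //.
  by rewrite ler_wpM2l.
have QS : opnorm Q <= opnorm S + e.
  rewrite -(subrK S Q) (le_trans (ler_opnormD _ _)) // addrC lerD //.
have SQ : opnorm (S * S - Q * Q) <= e * (2 * opnorm S + e).
  have -> : S * S - Q * Q = S * (S - Q) + (S - Q) * Q.
    by rewrite mulrBr mulrBl addrA subrK.
  rewrite (le_trans (ler_opnormD _ _)) //.
  have h1 := ler_opnormM S (S - Q); have h2 := ler_opnormM (S - Q) Q.
  rewrite opnorm_distC in pS.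
  have h3 : opnorm S * opnorm (S - Q) <= opnorm S * e.
    by rewrite ler_wpM2l ?opnorm_ge0.
  have h4 : opnorm (S - Q) * opnorm Q <= e * (opnorm S + e).
    by rewrite ler_pM ?opnorm_ge0.
  lra.
rewrite -(subrKA (Q * Q)) (le_trans (ler_opnormD _ _)) //.
apply: le_trans ek; rewrite /k; nra.
Qed.

Lemma bop_powR2 S : positive_op S -> bop_powR S 2 = S * S.
Proof.
move=> Sp; have S2 := @bop_powRP_ge1 2 _ (ler1n _ 2) Sp.
have [Ss _] := Sp.
apply: bop_nmB_eq0 => d d0; have [p [pf pX]] := S2 _ (divr_gt0 d0 (ltr0n R 2)).
rewrite -(subrKA (bop_horner p S)) (le_trans (ler_opnormD _ _)) // [leRHS]splitr.
rewrite lerD //; first by rewrite opnorm_distC.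
rewrite -{2 3}(bop_hornerX S) -bop_hornerM opnorm_hornerB_le ?divr_ge0 ?(ltW d0) //.
move=> t tT; have /andP[t0 _] := spectrum_positive Sp tT.
by have := pf _ tT; rewrite powR_mulrn // hornerM hornerX expr2.
Qed.

(* McCarthy's inequality: the tangent line of u |-> u^r at u = <S^4 x, x> lies
   below u^r, and this comparison passes to the functional calculus. *)
Lemma bop_powR_mccarthy S s x : positive_op S -> 1 <= s -> nm x = 1 ->
  (nm (S (S x)) ^+ 2) `^ s <= rin (bop_powR S (4 * s) x) x.
Proof.
move=> Sp s1 x1; have [Ss _] := Sp; set a := nm (S (S x)) ^+ 2.
have a0 : 0 <= a by exact: sqr_ge0.
have s4 : 1 <= 4 * s by lra.
(* The tangent line at [a], composed with [t ^ 4]; as [S ^+ 4] has mean [a] at [x], the mean of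
   [q(S)] is [a ^ s]. *)
pose q : {poly R} := (a `^ s - s * a `^ (s - 1) * a)%:P + (s * a `^ (s - 1)) *: 'X^4.
have := @cfc_ge _ _ _ _ _ q Sp (bop_powRP_ge1 s4 Sp) _ x.
have -> : rin (bop_horner q S x) x = a `^ s.
  rewrite bop_hornerD bop_hornerC bop_hornerZ bop_hornerXn bop_hornerX.
  rewrite bopDE !bopZE bop1E rinDl !rinZl rinxx x1.
  have -> : (S ^+ 4) x = S (S (S (S x))) by rewrite !exprS expr0 mulr1.
  by rewrite 2!Ss rinxx -/a expr1n; ring.
apply => t tS; have /andP[t0 _] := spectrum_positive Sp tS.
have := powR_tangent s1 a0 (exprn_ge0 4 t0).
rewrite -powR_mulrn // -powRrM powR_mulrn //.
rewrite hornerD hornerC hornerZ hornerXn; lra.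
Qed.

(** * Moduli of operators and the inequality at a unit vector *)

Lemma adjM_positive A : positive_op (adj A * A).
Proof.
have E x y : rin ((adj A * A) x) y = rin (A x) (A y).
  by rewrite bopME rinC -adjP rinC.
by split=> [x y|x]; rewrite E ?rinxx ?sqr_ge0 // [RHS]rinC E rinC.
Qed.

Lemma bop_abs_positive A : positive_op (bop_abs A).
Proof. exact/bop_powR_half_positive/adjM_positive. Qed.

Lemma bop_abs_powR2 A : bop_powR (bop_abs A) 2 = adj A * A.
Proof.
rewrite (bop_powR2 (bop_abs_positive A)) bop_powR_half_sqr //.
exact: adjM_positive.
Qed.

Lemma bop_abs_powR_mccarthy A s x : 1 <= s -> nm x = 1 ->
  (nm ((adj A * A) x) ^+ 2) `^ s <= rin (bop_powR (bop_abs A) (4 * s) x) x.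
Proof.
move=> s1 x1; rewrite -bop_abs_powR2 (bop_powR2 (bop_abs_positive A)) bopME.
by apply: bop_powR_mccarthy => //; exact: bop_abs_positive.
Qed.

(* 2 <u, x> x - u is the reflection of u, hence has the norm of u. *)
Lemma buzano x y z : nm x = 1 ->
  2 * (rin y x * rin z x) <= nm y * nm z + rin y z.
Proof.
move=> x1; set w := (2 * rin y x)%:C *: x - y.
have wE : nm w = nm y.
  apply/eqP; rewrite -(eqrXn2 (n := 2)) ?nm_ge0 // nm_sqrB nmZr x1 mulr1.
  by rewrite real_normK ?num_real // rinZl (rinC x); apply/eqP; ring.
have := rin_le w z; rewrite wE rinBl rinZl (rinC x z); lra.
Qed.

Lemma adj_inner_abs A B x :
  complex.Re `|inner ((adj B * A) x) x| <= nm (A x) * nm (B x).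
Proof.
have -> : inner ((adj B * A) x) x = inner (A x) (B x); last exact: inner_abs.
have E y : rin ((adj B * A) x) y = rin (A x) (B y) by rewrite bopME rinC -adjP rinC.
by rewrite !innerE !E bopZ_arg.
Qed.

(** [XA] and [XB] stand for the powers of the moduli, which enter only through lower bounds on their
    quadratic forms at [x]. *)
Lemma adj_inner_powR A B (XA XB : bop H) s x : 1 <= s -> nm x = 1 ->
  (nm ((adj A * A) x) ^+ 2) `^ s <= rin (XA x) x ->
  (nm ((adj B * B) x) ^+ 2) `^ s <= rin (XB x) x ->
  complex.Re `|inner ((adj B * A) x) x| `^ (2 * s) <=
    2^-1 * (opnorm (adj B * B * (adj A * A) + adj A * A * (adj B * B)) / 2) `^ s
    + 4^-1 * opnorm (XB + XA).
Proof.
move=> s1 x1; have s0 : 0 <= s by lra.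
set P := adj A * A; set Q := adj B * B => hA hB.
set D := opnorm _ / 2; have D0 : 0 <= D by rewrite divr_ge0 ?opnorm_ge0.
set u := nm (Q x) in hB *; set v := nm (P x) in hA *.
have u0 : 0 <= u := nm_ge0 _; have v0 : 0 <= v := nm_ge0 _.
have [Ps _] := adjM_positive A; have [Qs _] := adjM_positive B.
have PE : rin (P x) x = nm (A x) ^+ 2 by rewrite bopME rinC -adjP rinxx.
have QE : rin (Q x) x = nm (B x) ^+ 2 by rewrite bopME rinC -adjP rinxx.
have PQ : rin (P x) (Q x) <= D.
  have := rin_opnorm (Q * P + P * Q) x.
  rewrite x1 expr1n mulr1 ler_norml => /andP[_]; rewrite bopDE rinDl.
  rewrite (bopME Q P) (bopME P Q) Qs (Ps (Q x)) (rinC (Q x) (P x)) /D; lra.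
have XX : rin (XB x) x + rin (XA x) x <= opnorm (XB + XA).
  rewrite -rinDl -bopDE (le_trans (ler_norm _)) // (le_trans (rin_opnorm _ _)) //.
  by rewrite x1 expr1n mulr1.
set w := complex.Re _; have w0 : 0 <= w by rewrite -ler0c RRe_real ?normr_real.
have w2 : w ^+ 2 <= (u * v + D) / 2.
  have : w ^+ 2 <= nm (A x) ^+ 2 * nm (B x) ^+ 2.
    by rewrite -exprMn lerXn2r ?nnegrE ?mulr_ge0 ?nm_ge0 // adj_inner_abs.
  have := buzano (P x) (Q x) x1; rewrite PE QE -/u -/v; lra.
have uv0 : 0 <= u * v by rewrite mulr_ge0.
(* The mean of [u^2] and [v^2] dominates [u * v]; convexity then moves the power inside the mean. *)
have le1 : (u * v) `^ s <= ((u ^+ 2) `^ s + (v ^+ 2) `^ s) / 2.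
  apply: (le_trans _ (powR_midpoint s1 (sqr_ge0 u) (sqr_ge0 v))).
  rewrite ge0_ler_powR ?nnegrE ?divr_ge0 ?addr_ge0 ?sqr_ge0 //.
  by have := sqr_ge0 (u - v); nra.
have le2 : w `^ (2 * s) <= ((u * v) `^ s + D `^ s) / 2.
  apply: (le_trans _ (powR_midpoint s1 uv0 D0)).
  rewrite powRrM powR_mulrn // ge0_ler_powR ?nnegrE ?sqr_ge0 //.
  by rewrite divr_ge0 ?addr_ge0.
lra.
Qed.

Lemma ReNorm_ge0 c : 0 <= complex.Re `|c|.
Proof. by rewrite -ler0c RRe_real ?normr_real. Qed.

Lemma numradius_ge0 T : 0 <= numradius T.
Proof.
rewrite /numradius; set E := (X in sup X).
(* Without a supremum, as for the empty unit sphere of the zero space, [sup] returns 0. *)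
have [[[a Ea] ubE]|nE] := pselect (has_sup E); last by rewrite sup_out.
apply: le_trans (ub_le_sup ubE Ea).
by case: Ea => x _ <-; exact: ReNorm_ge0.
Qed.

End Powers.

Theorem theorem3p5 (R : realType) (H : hilbertType R) (A B : bop H) (r : R)
  (hr : 1 <= r) :
  numradius (adj B * A) `^ (2 * r) <=
    2^-1 * (opnorm (bop_powR (bop_abs B) 2 * bop_powR (bop_abs A) 2
                    + bop_powR (bop_abs A) 2 * bop_powR (bop_abs B) 2) / 2) `^ r
    + 4^-1 * opnorm (bop_powR (bop_abs B) (4 * r) + bop_powR (bop_abs A) (4 * r)).
Proof.
set K := _ + 4^-1 * _.
have K0 : 0 <= K by rewrite addr_ge0 // mulr_ge0 ?invr_ge0 ?powR_ge0 ?opnorm_ge0.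
have r2 : 0 < 2 * r by lra.
have w0 := numradius_ge0 (adj B * A).
(* Taking roots turns the claim into an upper bound on a supremum, which can be checked at each unit
   vector. *)
suff wK : numradius (adj B * A) <= K `^ (2 * r)^-1.
  rewrite -[leRHS](powRr1 K0) -[X in K `^ X](mulVf (lt0r_neq0 r2)) [leRHS]powRrM.
  by rewrite ge0_ler_powR ?nnegrE ?powR_ge0 ?(ltW r2).
(* If there is no unit vector, the numerical radius is the default 0. *)
have [E0|E0] := pselect ([set complex.Re `|inner ((adj B * A) x) x| |
    x in [set x : H | `|x| = 1]] !=set0)%classic; last first.
  by rewrite /numradius sup_out ?powR_ge0 // => -[].
apply: ge_sup => // _ [x /= x1 <-].
have nx : nm x = 1 by rewrite /nm x1.
have u0 := ReNorm_ge0 (inner ((adj B * A) x) x).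
rewrite -[leLHS](powRr1 u0) -[X in _ `^ X <= _](mulfV (lt0r_neq0 r2)) powRrM.
rewrite ge0_ler_powR ?nnegrE ?powR_ge0 ?invr_ge0 ?(ltW r2) //.
have hA := bop_abs_powR_mccarthy A hr nx; have hB := bop_abs_powR_mccarthy B hr nx.
have := adj_inner_powR hr nx hA hB.
by rewrite -(bop_abs_powR2 A) -(bop_abs_powR2 B).
Qed.
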